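(* The following two statements are equivalent. (A) (Semimetric fixed point theorem.) For every nonempty bounded semimetric space $(M,d)$ that has compact structure and normal structure, every nonexpansive mapping $T:M\to M$ (i.e. $d(Tx,Ty)\le d(x,y)$ for all $x,y\in M$) has a fixed point. (B) (Relational fixed point theorem.) Let $M$ be any nonempty set, let $\mathcal{E}=(R_n)_{n\in\mathbb{Z}}$ be any sequence of reflexive binary relations on $M$, and let $T:M\to M$ be any map, such that: - each $R_n$ is symmetric; - $R_n\subseteq R_{n-1}$ for all $n\in\mathbb{Z}$; - $\bigcup_{n\in\mathbb{Z}}R_n=M\times M$; - $\bigcap_{n\in\mathbb{Z}}R_n=\{(x,x):x\in M\}$; - $M$ is bounded, i.e. there is $N\in\mathbb{Z}$ with $M\times M\subseteq R_N$; - $(M,\mathcal{E})$ has compact structure and normal structure; - for every $n\in\mathbb{Z}$, $(x,y)\in R_n$ implies $(Tx,Ty)\in R_n$. Then $T$ has a fixed point.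
   Context: Semimetric side. A semimetric on $M$ is a map $d:M\times M\to\mathbb{R}$ with $d(x,y)\ge0$, $d(x,y)=0$ if and only if $x=y$, and $d(x,y)=d(y,x)$, for all $x,y \in M$ (no triangle inequality). The space $(M,d)$ is bounded if $\sup_{x,y\in M}d(x,y)<\infty$. For $x\in M$ and $r>0$, the ball is $B(x,r)=\{y\in M: d(x,y)\le r\}$. A subset of $M$ is admissible if it is an intersection of balls; $\mathcal{A}(M)$ is the family of admissible subsets. For a nonempty bounded $A\subseteq M$ put $r_x(A)=\sup\{d(x,y):y\in A\}$, $r_d(A)=\inf\{r_x(A):x\in A\}$ and $\delta_d(A)=\sup\{d(x,y):x,y\in A\}$. The space $(M,d)$ has compact structure if for every family $\mathcal{F}$ of members of $\mathcal{A}(M)$ such that all finite subfamilies have nonempty intersection, the intersection of $\mathcal{F}$ is nonempty. It has normal structure if $r_d(A)<\delta_d(A)$ for every $A\in\mathcal{A}(M)$ with at least two points. Relational side. Given $\mathcal{E}=(R_n)_{n\in\mathbb{Z}}$ on $M$, the $\mathcal{E}$-ball with center $x\in M$ and radius $R_n$ is $\mathcal{B}(x,R_n)=\{y\in M:(x,y)\in R_n\}$. A subset of $M$ is $\mathcal{E}$-admissible if it is an intersection of $\mathcal{E}$-balls; $\mathcal{A}_{\mathcal{E}}(M)$ is the family of $\mathcal{E}$-admissible subsets. For $A\subseteq M$ put $r_{\mathcal{E}}(A)=\{R_n\in\mathcal{E}: A\subseteq\mathcal{B}(x,R_n)\text{ for some }x\in A\}$ and $\delta_{\mathcal{E}}(A)=\{R_n\in\mathcal{E}: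 A\times A\subseteq R_n\}$. The pair $(M,\mathcal{E})$ has compact structure if for every family of members of $\mathcal{A}_{\mathcal{E}}(M)$ all of whose finite subfamilies have nonempty intersection, the whole family has nonempty intersection. It has normal structure if $r_{\mathcal{E}}(A)\neq\delta_{\mathcal{E}}(A)$ for every $A\in\mathcal{A}_{\mathcal{E}}(M)$ with at least two points. A binary relation $R$ on $M$ is reflexive if $(x,x)\in R$ for all $x\in M$, and symmetric if $(x,y)\in R$ implies $(y,x)\in R$. *)

(* Defs.v *)
From HB Require Import structures.
From mathcomp Require Import all_boot all_order all_algebra.
From mathcomp Require Import boolp classical_sets cardinality reals.

Set Implicit Arguments.
Unset Strict Implicit.
Unset Printing Implicit Defensive.

Import Order.TTheory GRing.Theory Num.Theory.

Local Open Scope classical_set_scope.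
Local Open Scope ring_scope.

Definition at_least_two_points (M : Type) (A : set M) : Prop :=
  exists x y, [/\ A x, A y & x <> y].

(* The empty intersection, i.e. [set: M], is included; it is itself a ball
   as soon as the space is nonempty and bounded. *)
Definition intersections_of (M : Type) (balls : set (set M)) : set (set M) :=
  [set A | exists2 F : set (set M), F `<=` balls & A = \bigcap_(B in F) B].

Definition has_finite_intersection_property (M : Type) (F : set (set M)) :
  Prop :=
  forall G : set (set M), finite_set G -> G `<=` F ->
    \bigcap_(A in G) A !=set0.

Definition compact_family (M : Type) (adm : set (set M)) : Prop :=
  forall F : set (set M), F `<=` adm ->
    has_finite_intersection_property F -> \bigcap_(A in F) A !=set0.

Definition semimetric (R : realType) (M : Type) (d : M -> M -> R) : Prop :=
  [/\ forall x y, 0 <= d x y,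
      forall x y, d x y = 0 <-> x = y
    & forall x y, d x y = d y x].

Section Semimetric.
Context (R : realType) (M : Type) (d : M -> M -> R).

Definition bounded_semimetric : Prop :=
  has_ubound [set d x y | x in [set: M] & y in [set: M]].

Definition sm_ball (x : M) (r : R) : set M := [set y | d x y <= r].

Definition sm_balls : set (set M) :=
  [set B | exists x r, 0 < r /\ B = sm_ball x r].

Definition sm_admissible : set (set M) := intersections_of sm_balls.

Definition sm_radius_at (x : M) (A : set M) : R := sup [set d x y | y in A].

Definition sm_radius (A : set M) : R := inf [set sm_radius_at x A | x in A].

Definition sm_diameter (A : set M) : R := sup [set d x y | x in A & y in A].

Definition sm_compact_structure : Prop := compact_family sm_admissible.

Definition sm_normal_structure : Prop :=
  forall A : set M, sm_admissible A -> at_least_two_points A ->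
    sm_radius A < sm_diameter A.

Definition nonexpansive (T : M -> M) : Prop :=
  forall x y, d (T x) (T y) <= d x y.

End Semimetric.

Definition reflexive_relation (M : Type) (S : set (M * M)) : Prop :=
  forall x, S (x, x).

Definition symmetric_relation (M : Type) (S : set (M * M)) : Prop :=
  forall x y, S (x, y) -> S (y, x).

Section Relational.
Context (M : Type) (E : int -> set (M * M)).

Definition bounded_relational : Prop :=
  exists N : int, [set: M] `*` [set: M] `<=` E N.

Definition rel_ball (x : M) (S : set (M * M)) : set M := [set y | S (x, y)].

Definition rel_balls : set (set M) :=
  [set B | exists x n, B = rel_ball x (E n)].

Definition rel_admissible : set (set M) := intersections_of rel_balls.

(* [rel_radius] and [rel_diameter] are sets of relations, not of indices. *)
Definition rel_radius (A : set M) : set (set (M * M)) :=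
  [set S | range E S /\ exists2 x, A x & A `<=` rel_ball x S].

Definition rel_diameter (A : set M) : set (set (M * M)) :=
  [set S | range E S /\ A `*` A `<=` S].

Definition rel_compact_structure : Prop := compact_family rel_admissible.

Definition rel_normal_structure : Prop :=
  forall A : set M, rel_admissible A -> at_least_two_points A ->
    rel_radius A <> rel_diameter A.

End Relational.

(* Main.v *)
(* Both statements are instances of one Kirk-Penot theorem for a set of symmetric
   relations preserved by [T] (for a semimetric, the relations [d x y <= r] with
   [0 < r]), so each of them holds outright and no translation between them is
   needed. Compactness and Zorn's lemma give a minimal nonempty admissible set [A]
   with [T @` A `<=` A]. If [A] had two points, normal structure would yield a
   relation [S] with [A] inside some [S]-ball centered in [A] but [A x A] not
   inside [S]. The set of such centers is again admissible, nonempty and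
   invariant, so it is all of [A], which forces [A x A] inside [S]. *)
Require Import Defs.
From HB Require Import structures.
From mathcomp Require Import all_boot all_order all_algebra.
From mathcomp Require Import boolp classical_sets cardinality reals.

Set Implicit Arguments.
Unset Strict Implicit.
Unset Printing Implicit Defensive.

Import Order.TTheory GRing.Theory Num.Theory.

Local Open Scope classical_set_scope.
Local Open Scope ring_scope.

(** Finitely many members of a chain have a smallest one, which lies in their intersection. *)
Lemma chain_finite_intersection (M : Type) (F : set (set M)) :
  [set: M] !=set0 -> total_on F subset -> (forall A, F A -> A !=set0) ->
  has_finite_intersection_property F.
Proof.
move=> M0 Ftot Fne G /finite_seqP[s ->] sF.
(* The alternative [B = [set: M]] starts the induction: an empty subfamily has no smallest
   member. *)
suff [B FB Bs] : exists2 B, F B \/ B = [set: M] &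
    forall A, A \in s -> B `<=` A.
  have [x Bx] : B !=set0 by case: FB => [/Fne|->].
  by exists x => A As; exact: Bs Bx.
elim: s sF => [_|A s IHs sF]; first by exists [set: M]; [right|].
have [B FB Bs] : exists2 B, F B \/ B = [set: M] &
    forall A, A \in s -> B `<=` A.
  by apply: IHs => C Cs; apply: sF; rewrite /= inE Cs orbT.
have FA : F A by apply: sF; rewrite /= inE eqxx.
have [AB|BA] : A `<=` B \/ B `<=` A.
- by case: FB => [FB|->]; [exact: Ftot|left].
- exists A; first by left.
  move=> C; rewrite inE => /orP[/eqP->//|Cs].
  exact: subset_trans AB (Bs _ Cs).
- exists B => // C; rewrite inE => /orP[/eqP->//|Cs]; exact: Bs.
Qed.

Section Admissible.
Context (M : Type) (balls : set (set M)).
Implicit Types (F : set (set M)) (X A B : set M).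

(** The closure operator whose closed sets are the admissible sets. *)
Definition ball_hull X : set M :=
  \bigcap_(B in [set B | balls B /\ X `<=` B]) B.

Lemma sub_ball_hull X : X `<=` ball_hull X.
Proof. by move=> x Xx B [_]; apply. Qed.

Lemma ball_hull_min X A :
  intersections_of balls A -> X `<=` A -> ball_hull X `<=` A.
Proof.
move=> [F Fballs ->] XF x hx B FB; apply: hx; split; first exact: Fballs.
by move=> y /XF; apply.
Qed.

Lemma ball_hull_admissible X : intersections_of balls (ball_hull X).
Proof. by exists [set B | balls B /\ X `<=` B] => // B []. Qed.

Lemma ball_admissible B : balls B -> intersections_of balls B.
Proof.
by move=> ballsB; exists [set B]; [move=> _ ->|rewrite bigcap_set1].
Qed.

(** Such an intersection equals its own hull, so no family of balls has to be chosen for each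
    member. *)
Lemma bigcap_admissible F : F `<=` intersections_of balls ->
  intersections_of balls (\bigcap_(A in F) A).
Proof.
move=> Fadm.
suff -> : \bigcap_(A in F) A = ball_hull (\bigcap_(A in F) A).
  exact: ball_hull_admissible.
apply/seteqP; split; first exact: sub_ball_hull.
move=> x hx A FA; apply: (ball_hull_min (Fadm _ FA) _ hx).
exact: bigcap_inf.
Qed.

Lemma minimal_invariant_admissible (T : M -> M) :
  [set: M] !=set0 -> compact_family (intersections_of balls) ->
  let Q A := [/\ A !=set0, intersections_of balls A & T @` A `<=` A] in
  exists2 A, Q A & forall B, Q B -> B `<=` A -> A `<=` B.
Proof.
move=> M0 cpt Q.
(* [Zorn_bigcup] gives maximal sets from unions of chains; passing to complements turns this into
   minimal sets and intersections. *)
have [F FQ Ftot|X [QX Xmax]] := @Zorn_bigcup M [set X | Q (~` X)].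
- have GQ A : (setC @` F) A -> Q A by move=> [X /FQ QX <-].
  have bigcapE : ~` (\bigcup_(X in F) X) = \bigcap_(A in setC @` F) A.
    by rewrite setC_bigcup bigcap_image.
  rewrite /= bigcapE; split.
  + apply: cpt => [A /GQ[]//|]; apply: chain_finite_intersection => //.
      move=> _ _ [X FX <-] [Y FY <-].
      by case: (Ftot _ _ FX FY) => XY; [right|left]; exact: subsetC.
    by move=> A /GQ[].
  + by apply: bigcap_admissible => A /GQ[].
  + move=> _ [x Fx <-] A FA; case: (GQ _ FA) => _ _; apply.
    by exists x => //; exact: Fx.
- exists (~` X) => // B QB BX; apply: contrapT => XB.
  apply: (Xmax (~` B)); last by rewrite /= setCK.
  split; first by rewrite -[X]setCK; exact: subsetC.
  by move=> /subsetC; rewrite setCK.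
Qed.

End Admissible.

(** Dropping the index treats integer indices and real radii alike. *)
Definition relation_balls (M : Type) (Es : set (set (M * M))) : set (set M) :=
  [set B | exists x S, Es S /\ B = rel_ball x S].

Lemma relation_preserving_fixed_point (M : Type) (Es : set (set (M * M)))
    (T : M -> M) :
  [set: M] !=set0 ->
  (forall S, Es S -> symmetric_relation S) ->
  compact_family (intersections_of (relation_balls Es)) ->
  (forall A, intersections_of (relation_balls Es) A -> at_least_two_points A ->
     exists S, [/\ Es S, exists2 x, A x & A `<=` rel_ball x S &
       ~ A `*` A `<=` S]) ->
  (forall S, Es S -> forall x y, S (x, y) -> S (T x, T y)) ->
  exists x, T x = x.
Proof.
move=> M0 Esym cpt normal ET.
have [A [[x0 Ax0] Aadm TA] Amin] := minimal_invariant_admissible T M0 cpt.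
have [A2|A1] := pselect (at_least_two_points A); last first.
  (* Here [A] is the single point [x0], which invariance forces to be fixed. *)
  exists x0; apply: contrapT => Tx0; apply: A1; exists (T x0), x0.
  by split => //; apply: TA; exists x0.
have hull_adm := @ball_hull_admissible _ (relation_balls Es) (T @` A).
(* A minimal invariant set is the hull of its image. *)
have Ahull : A `<=` ball_hull (relation_balls Es) (T @` A).
  apply: Amin; last exact: ball_hull_min.
  split=> //; first by exists (T x0); apply: sub_ball_hull; exists x0.
  move=> _ [x hx <-]; apply: sub_ball_hull; exists x => //.
  exact: (ball_hull_min Aadm TA).
have [S [ES [c Ac AcS] AS]] := normal A Aadm A2.
(* The points of [A] that are centers of a ball of radius [S] containing [A]
   form an invariant admissible set, so by minimality they are all of [A]. *)
pose centers := \bigcap_(B in A |` [set rel_ball z S | z in A]) B.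
(* By symmetry, [x] lies in the [S]-ball around every [z] in [A] iff the [S]-ball around [x]
   contains [A]. *)
have centersP x : centers x <-> A x /\ A `<=` rel_ball x S.
  split=> [cx|[Ax xS] B [->//|[z Az <-]]]; last by apply: Esym => //; exact: xS.
  split=> [|z Az]; first by apply: cx; left.
  by apply: Esym => //; apply: (cx (rel_ball z S)); right; exists z.
have Acenters : A `<=` centers.
  apply: Amin; last by move=> x /centersP[].
  split; first by exists c; exact/centersP.
    apply: bigcap_admissible => B [->//|[z Az <-]].
    by apply: ball_admissible; exists z, S.
  move=> _ [x /centersP[Ax xS] <-]; apply/centersP.
  split; first by apply: TA; exists x.
  apply: (subset_trans Ahull); apply: ball_hull_min.
    by apply: ball_admissible; exists (T x), S.
  by move=> _ [y Ay <-]; apply: ET => //; exact: xS.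
exfalso; apply: AS => -[x y] [/= Ax Ay].
by have /centersP[_] := Acenters x Ax; apply.
Qed.

Lemma rel_ballsE (M : Type) (E : int -> set (M * M)) :
  rel_balls E = relation_balls (range E).
Proof.
apply/seteqP; split=> B.
  by move=> [x [n ->]]; exists x, (E n); split=> //; exists n.
by move=> [x [_ [[n _ <-] ->]]]; exists x, n.
Qed.

(** For nonempty [A] the diameter is included in the radius, so if they differ, some relation is in
    the radius only. *)
Lemma rel_normal_center (M : Type) (E : int -> set (M * M)) (A : set M) :
  rel_normal_structure E -> rel_admissible E A -> at_least_two_points A ->
  exists S, [/\ range E S, exists2 x, A x & A `<=` rel_ball x S &
    ~ A `*` A `<=` S].
Proof.
move=> norm Aadm A2; have [x [_ [Ax _ _]]] := A2.
apply: contrapT => noS; apply: (norm A Aadm A2); apply/seteqP; split=> S.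
  move=> [ES xS]; split=> //; apply: contrapT => AS; apply: noS.
  by exists S.
by move=> [ES AS]; split=> //; exists x => // y Ay; exact: AS.
Qed.

Definition sm_relations (R : realType) (M : Type) (d : M -> M -> R) :
    set (set (M * M)) :=
  [set [set p | d p.1 p.2 <= r] | r in [set r | 0 < r]].

Lemma sm_ballsE (R : realType) (M : Type) (d : M -> M -> R) :
  sm_balls d = relation_balls (sm_relations d).
Proof.
apply/seteqP; split=> B.
  move=> [x [r [r0 ->]]]; exists x, [set p | d p.1 p.2 <= r].
  by split=> //; exists r.
by move=> [x [_ [[r r0 <-] ->]]]; exists x, r.
Qed.

(** An infimum below the diameter gives a center [x] in [A] with [sm_radius_at d x A] below the
    diameter; this number is the radius of the relation sought. *)
Lemma sm_normal_center (R : realType) (M : Type) (d : M -> M -> R)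
    (A : set M) :
  semimetric d -> bounded_semimetric d -> sm_normal_structure d ->
  sm_admissible d A -> at_least_two_points A ->
  exists S, [/\ sm_relations d S, exists2 x, A x & A `<=` rel_ball x S &
    ~ A `*` A `<=` S].
Proof.
move=> [d_ge0 d_eq0 _] [D dD] norm Aadm A2.
have [a [b [Aa Ab ab]]] := A2.
have [||_ [x Ax <-] xA] := @inf_lt _ [set sm_radius_at d x A | x in A]
  (sm_diameter d A).
- by exists (sm_radius_at d a A), a.
- exact: norm.
have xr y : A y -> d x y <= sm_radius_at d x A.
  move=> Ay; apply: ub_le_sup; last by exists y.
  by exists D => _ [z _ <-]; apply: dD; exists x => //; exists z.
(* [sm_relations] admits positive radii only; one of the distinct points [a] and [b] differs from
   [x] and makes this radius positive. *)
have radius_gt0 z : A z -> x <> z -> 0 < sm_radius_at d x A.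
  move=> Az xz; apply: lt_le_trans (xr z Az).
  by rewrite lt_def d_ge0 andbT; apply/eqP => /d_eq0.
exists [set p | d p.1 p.2 <= sm_radius_at d x A]; split.
- exists (sm_radius_at d x A) => //=.
  have [xa|/(radius_gt0 a Aa)//] := pselect (x = a).
  by apply: (radius_gt0 b Ab); rewrite xa.
- by exists x => // y /xr.
(* If the relation contained [A x A], its radius would bound all distances in [A], hence the
   diameter, against [xA]. *)
- move=> Ar; move: xA; apply/negP; rewrite -leNgt; apply: ge_sup.
    by exists (d a a), a => //; exists a.
  by move=> _ [y Ay [z Az <-]]; exact: (Ar (y, z)).
Qed.

Theorem theorem3p3 (R : realType) :
  (forall (M : Type) (d : M -> M -> R),
     [set: M] !=set0 ->
     semimetric d ->
     bounded_semimetric d ->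
     sm_compact_structure d ->
     sm_normal_structure d ->
     forall T : M -> M, nonexpansive d T -> exists x, T x = x)
  <->
  (forall (M : Type) (E : int -> set (M * M)) (T : M -> M),
     [set: M] !=set0 ->
     (forall n, reflexive_relation (E n)) ->
     (forall n, symmetric_relation (E n)) ->
     (forall n, E n `<=` E (n - 1)) ->
     \bigcup_(n in [set: int]) E n = [set: M] `*` [set: M] ->
     \bigcap_(n in [set: int]) E n = diagonal ->
     bounded_relational E ->
     rel_compact_structure E ->
     rel_normal_structure E ->
     (forall n x y, E n (x, y) -> E n (T x, T y)) ->
     exists x, T x = x).
Proof.
split=> _.
- move=> M E T M0 _ Esym _ _ _ _ Ecpt Enorm ET.
  apply: (@relation_preserving_fixed_point M (range E) T) => //.
  + by move=> _ [n _ <-]; exact: Esym.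
  + rewrite -rel_ballsE; exact: Ecpt.
  + by move=> A Aadm A2; apply: rel_normal_center => //;
      rewrite /rel_admissible rel_ballsE.
  + by move=> _ [n _ <-]; exact: ET.
- move=> M d M0 [d_ge0 d_eq0 d_sym] dbd dcpt dnorm T Tne.
  apply: (@relation_preserving_fixed_point M (sm_relations d) T) => //.
  + by move=> _ [r _ <-] x y /=; rewrite d_sym.
  + rewrite -sm_ballsE; exact: dcpt.
  + by move=> A Aadm A2; apply: sm_normal_center => //;
      rewrite /sm_admissible sm_ballsE.
  + by move=> _ [r _ <-] x y /=; exact: le_trans (Tne x y).
Qed.
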